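(* Let $n \ge 3$ and let $S$ be an infinite commutative anti-negative semiring without zero divisors. Then the monoid $M_n(S)$ is not finitely generated.
   Context: A semiring $S$ is a set with two operations $+,\cdot$ such that $(S,+)$ is a commutative monoid with identity $0_S$, $(S,\cdot)$ is a monoid with identity $1_S$, multiplication distributes over addition on both sides, and $x0_S = 0_Sx = 0_S$ for all $x$; it is commutative if $(S,\cdot)$ is commutative. $S$ is anti-negative if for all $x,y\in S$, $x+y=0_S$ if and only if $x=y=0_S$. $S$ is without zero divisors if $xy = 0_S$ implies $x=0_S$ or $y=0_S$. $M_n(S)$ is the monoid of all $n\times n$ matrices over $S$ under matrix multiplication. *)

(* Defs.v *)
From HB Require Import structures.
From mathcomp Require Import all_boot all_order all_algebra.
From mathcomp Require Import classical_sets cardinality.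
Set Implicit Arguments.
Unset Strict Implicit.
Unset Printing Implicit Defensive.
Import GRing.Theory.
Local Open Scope ring_scope.

Definition antinegative (S : pzSemiRingType) : Prop :=
  forall x y : S, x + y = 0 <-> x = 0 /\ y = 0.

Definition no_zero_divisors (S : pzSemiRingType) : Prop :=
  forall x y : S, x * y = 0 -> x = 0 \/ y = 0.

(* This concerns the multiplicative monoid (R, *, 1) only; the empty word
   yields 1. *)
Definition mul_finitely_generated (R : pzSemiRingType) : Prop :=
  exists G : seq R, forall x : R,
    exists2 w : seq R, {subset w <= G} & x = \prod_(g <- w) g.

(* Main.v *)
Require Import Defs.
From mathcomp Require Import all_boot all_order all_algebra.
From mathcomp Require Import classical_sets cardinality.
Set Implicit Arguments.
Unset Strict Implicit.
Unset Printing Implicit Defensive.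
Import GRing.Theory.
Local Open Scope ring_scope.
Local Open Scope classical_set_scope.

(** Let [P] be the permutation matrix of the [n]-cycle [i |-> i + 1].  The
    support of [1 + P] is, seen as a bipartite graph, a cycle with [2n] edges;
    as [n >= 3] it contains no 4-cycle, so its complete bipartite subgraphs have
    at most two edges.  Since [S] is anti-negative without zero divisors, a
    factorization [X = A *m B] of a matrix [X] with that support covers the [2n]
    edges by the [n] complete bipartite subgraphs
    (support of column [k] of [A]) x (support of row [k] of [B]).
    Hence these are paths of length two that partition the cycle, and either all
    of them are centred at rows or all at columns: [A] has a single nonzero
    entry in each row, or [B] in each column ([cycle_supported_prime]).

    Applied along a word in the generators, this shows that [X = D *m g *m E]
    for a single generator [g], where [D] has at most one nonzero entry in each
    row and [E] in each column ([cycle_supported_word]).  Such [D] and [E]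
    merely select and rescale entries of [g], and both the product of the
    diagonal entries of [X] and the product of its entries at the places
    [(i, i + 1)] get rescaled by the same factor, the product of the selected
    entries of [D] and [E].  For [X = cycle_mx s] these two products are [s] and
    [1]; the latter makes the common factor the inverse of a product of entries
    of [g], so that [s] is determined by [g] and the two selection functions
    ([cycle_mx_factor]).  There are finitely many such data, but infinitely many
    nonzero [s]. *)

Section CyclePrimes.
Variables (m : nat) (S : comPzSemiRingType).
Hypotheses (S_antinegative : antinegative S) (S_nzd : no_zero_divisors S).
(* Indices are taken modulo m.+3, so that [i + 1] is the cyclic successor. *)
Local Notation I := 'I_m.+3.
Implicit Types (i j k : I) (A B D E X : 'M[S]_m.+3).

(** Multiplying by such a matrix on the left (for [row_select]) or on the right
    (for [col_select]) selects and rescales rows, resp. columns. *)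
Definition row_select (f : I -> I) A := forall i k, A i k != 0 -> k = f i.
Definition col_select (f : I -> I) B := forall k j, B k j != 0 -> k = f j.
Definition cycle_supported X :=
  forall i j, (X i j != 0) = (j == i) || (j == i + 1).

Definition cycle_mx (s : S) : 'M[S]_m.+3 :=
  \matrix_(i, j) if j == i then if i == 0 then s else 1
                 else if j == i + 1 then 1 else 0.

Lemma succ_neq i : (i + 1 == i) = false.
Proof. by rewrite -[X in _ == X]addr0 (inj_eq (addrI i)). Qed.

(** The hypothesis [n >= 3] enters here: for [n = 2] the support of [1 + P]
    would be complete. *)
Lemma succ2_neq i : (i + 1 + 1 == i) = false.
Proof. by rewrite -addrA -[X in _ == X]addr0 (inj_eq (addrI i)). Qed.

Lemma succ_ind (p : pred I) i0 :
  p i0 -> (forall i, p i -> p (i + 1)) -> forall i, p i.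
Proof.
move=> p0 pS i; rewrite -(subrK i0 i) -[i - i0]natr_Zp addrC.
by elim: (nat_of_ord _) => [|l IHl]; rewrite ?addr0 // mulrSr addrA; apply: pS.
Qed.

Lemma sum_neq0 (F : I -> S) k : F k != 0 -> \sum_l F l != 0.
Proof.
rewrite (bigD1 k) //=; apply: contraNneq.
by case/S_antinegative => ->.
Qed.

Lemma mulmx_neq0 A B i k j :
  A i k != 0 -> B k j != 0 -> (A *m B) i j != 0.
Proof.
move=> Ak Bk; rewrite mxE; apply: (@sum_neq0 _ k).
by apply/eqP => /S_nzd[] /eqP; apply/negP.
Qed.

Lemma mulmx_neq0_ex A B i j :
  (A *m B) i j != 0 -> exists k, A i k != 0 /\ B k j != 0.
Proof.
rewrite mxE => nz; have [k /andP[]|no] := pickP (fun k => (A i k != 0) && (B k j != 0)).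
  by exists k.
case/eqP: nz; apply: big1 => k _; move: (no k).
by case: eqP => [->|_ /negbFE/eqP ->]; rewrite ?mul0r ?mulr0.
Qed.

(** If [h] advances one point then it must advance the next one too, since
    the place of the latter is now taken; so the advanced points, if there are
    any, form the whole cycle. *)
Lemma injective_step (h : I -> I) :
    injective h -> (forall i, (h i == i) || (h i == i + 1)) ->
  (forall i, h i = i) \/ (forall i, h i = i + 1).
Proof.
move=> h_inj step.
have [i0 /eqP hi0|all_fix] := pickP (fun i => h i == i + 1).
  right=> i; apply/eqP; apply: (@succ_ind (fun i => h i == i + 1) i0 _ _ i).
    exact/eqP.
  move=> {}i /eqP hi; case/orP: (step (i + 1)) => // /eqP hSi.
  by have /eqP := h_inj _ _ (etrans hSi (esym hi)); rewrite succ_neq.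
by left=> i; have := step i; rewrite all_fix orbF => /eqP.
Qed.

(** Let [f i] (resp. [g i]) be an index through which the product reaches the
    entry [(i, i)] (resp. [(i, i + 1)]).  Both maps are injective because the
    support contains no 4-cycle, hence are permutations.  The map [f^-1 \o g] is
    then the identity (paths centred at rows) or the rotation (paths centred at
    columns).  In the first case row [f i] of [B] is nonzero in both columns [i]
    and [i + 1], and row [i] is the only one of the product that is nonzero in
    these two columns: thus [A j (f i) != 0] forces [j = i].  The second case is
    symmetric, and [f] serves as the selection function in both. *)
Lemma cycle_supported_prime A B : cycle_supported (A *m B) ->
  (exists f, row_select f A) \/ (exists f, col_select f B).
Proof.
move=> supp.
have edge i k j : A i k != 0 -> B k j != 0 -> (j == i) || (j == i + 1).
  by move=> Ak Bk; rewrite -supp (mulmx_neq0 Ak Bk).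
have through i j : (j == i) || (j == i + 1) ->
    exists k, A i k != 0 /\ B k j != 0.
  by rewrite -supp; apply: mulmx_neq0_ex.
have /fin_all_exists[f Hf] : forall i, exists k, A i k != 0 /\ B k i != 0.
  by move=> i; apply: through; rewrite eqxx.
have /fin_all_exists[g Hg] : forall i, exists k, A i k != 0 /\ B k (i + 1) != 0.
  by move=> i; apply: through; rewrite eqxx orbT.
have f_inj : injective f.
  move=> i j fij; have [Ai Bi] := Hf i; have [Aj Bj] := Hf j.
  rewrite fij in Ai Bi.
  case/orP: (edge _ _ _ Ai Bj) => /eqP // ji.
  by have := edge _ _ _ Aj Bi; rewrite ji ![i == _]eq_sym succ_neq succ2_neq.
have g_inj : injective g.
  move=> i j gij; have [Ai Bi] := Hg i; have [Aj Bj] := Hg j.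
  rewrite gij in Ai Bi.
  case/orP: (edge _ _ _ Ai Bj) => [/eqP ji|/eqP/addIr //].
  by have := edge _ _ _ Aj Bi; rewrite -ji succ2_neq (inj_eq (addIr 1)) succ_neq.
have [f' fK f'K] := injF_bij f_inj.
have [] := @injective_step (f' \o g).
- exact: inj_comp (can_inj f'K) g_inj.
- move=> i; have [Ai _] := Hg i; have [_ Bh] := Hf (f' (g i)).
  by rewrite f'K in Bh; exact: (edge _ _ _ Ai Bh).
- (* paths centred at rows *)
  move=> fg; left; exists f => i k; rewrite -{1}[k]f'K => Aik.
  have [_ B1] := Hf (f' k); have [_ B2] := Hg (f' k).
  have gf : g (f' k) = f (f' k) by rewrite -{2}(fg (f' k)) /= f'K.
  rewrite gf in B2; have := edge _ _ _ Aik B1; have := edge _ _ _ Aik B2.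
  rewrite (inj_eq (addIr 1)) => H /orP[/eqP <-|/eqP E]; first by rewrite f'K.
  by move: H; rewrite E succ2_neq succ_neq.
(* paths centred at columns *)
move=> fg; right; exists f => k j; rewrite -{1}[k]f'K => Bkj.
set i := f' k - 1; have iE : f' k = i + 1 by rewrite subrK.
have [A1 _] := Hf (i + 1); have [A2 _] := Hg i.
have gf : g i = f (i + 1) by rewrite -(fg i) /= f'K.
rewrite gf in A2; rewrite iE in Bkj.
have := edge _ _ _ A1 Bkj; have := edge _ _ _ A2 Bkj.
move=> H /orP[/eqP ->|/eqP E]; first by rewrite -iE f'K.
by move: H; rewrite E succ2_neq (inj_eq (addIr 1)) succ_neq.
Qed.

Lemma cycle_supported_not_select X f :
  cycle_supported X -> ~ row_select f X.
Proof.
move=> supp sel; have /eqP := succ_neq 0; apply.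
rewrite (sel 0 (0 + 1)) ?supp ?eqxx ?orbT //.
by rewrite -(sel 0 0) // supp eqxx.
Qed.

(** Letters are moved into the left factor [D] as long as it keeps at most one
    nonzero entry per row; by primality, when this fails the remaining word
    has at most one nonzero entry per column.  It must fail at some letter,
    since a matrix with cyclic support has two nonzero entries per row. *)
Lemma cycle_supported_word (w : seq 'M[S]_m.+3) D f :
    row_select f D -> cycle_supported (D *m \prod_(g <- w) g) ->
  exists g D' E f' h, [/\ g \in w, row_select f' D', col_select h E &
    D *m \prod_(g <- w) g = D' *m g *m E].
Proof.
elim: w D f => [|g w IHw] D f selD.
  rewrite big_nil mulmx1 => supp.
  by case: (cycle_supported_not_select supp selD).
rewrite big_cons -mulmxE mulmxA => supp.
have [[f1 selDg]|[h selw]] := cycle_supported_prime supp.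
  have [g' [D' [E [f' [h [gw ? ? ?]]]]]] := IHw _ _ selDg supp.
  by exists g', D', E, f', h; rewrite inE gw orbT.
by exists g, D, (\prod_(g <- w) g), f, h; rewrite inE eqxx.
Qed.

Lemma select_mulmxE D g E f h i j : row_select f D -> col_select h E ->
  (D *m g *m E) i j = D i (f i) * g (f i) (h j) * E (h j) j.
Proof.
move=> selD selE; rewrite mxE (bigD1 (h j)) //= [X in _ + X]big1 ?addr0.
  rewrite mxE (bigD1 (f i)) //= [X in _ + X]big1 ?addr0 // => k kf.
  have [->|/selD kE] := eqVneq (D i k) 0; first by rewrite mul0r.
  by rewrite kE eqxx in kf.
move=> k kh; have [->|/selE kE] := eqVneq (E k j) 0; first by rewrite mulr0.
by rewrite kE eqxx in kh.
Qed.

Lemma cycle_mx_supported (s : S) :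
  (1 : S) != 0 -> s != 0 -> cycle_supported (cycle_mx s).
Proof.
move=> nz1 nzs i j; rewrite mxE; have [_|_] := eqVneq j i; first by case: ifP.
by have [_|_] := eqVneq j (i + 1); rewrite ?eqxx.
Qed.

(** The factor [u] is the product of the selected entries [D i (f i)] and
    [E (h j) j]; it is the same in both equations because [i |-> i + 1] permutes
    the columns. *)
Lemma cycle_mx_factor (s : S) D g E f h :
    row_select f D -> col_select h E -> cycle_mx s = D *m g *m E ->
  exists2 u, u * \prod_i g (f i) (h (i + 1)) = 1
           & u * \prod_i g (f i) (h i) = s.
Proof.
move=> selD selE eqX.
have entry i j : cycle_mx s i j = D i (f i) * E (h j) j * g (f i) (h j).
  by rewrite eqX (select_mulmxE _ _ _ selD selE) mulrAC.
exists (\prod_i D i (f i) * \prod_i E (h i) i).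
  rewrite [X in _ * X * _](reindex_inj (addIr (1 : I))) /= -!big_split /=.
  by apply: big1 => i _; rewrite -entry mxE succ_neq eqxx.
rewrite -!big_split /= (bigD1 0) //= big1 ?mulr1 => [|i /negPf i0].
  by rewrite -entry mxE !eqxx.
by rewrite -entry mxE eqxx i0.
Qed.

End CyclePrimes.

Lemma infinite_oner_neq0 (S : pzSemiRingType) :
  infinite_set [set: S] -> (1 : S) != 0.
Proof.
move=> S_infinite; apply/eqP => S_trivial; apply: S_infinite.
apply: (sub_finite_set _ (finite_set1 (0 : S))) => x _ /=.
by rewrite -[x]mul1r S_trivial mul0r.
Qed.

Theorem theorem4p6 (n : nat) (S : comPzSemiRingType)
  (hn : (3 <= n)%N)
  (S_infinite : infinite_set [set: S])
  (S_antinegative : antinegative S)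
  (S_nzd : no_zero_divisors S) :
  ~ mul_finitely_generated 'M[S]_n.
Proof.
case: n hn => [|[|[|m]]] // _ [G genG].
have nz1 := infinite_oner_neq0 S_infinite.
pose I := 'I_m.+3.
pose T := ('M[S]_m.+3 * {ffun I -> I} * {ffun I -> I})%type.
pose ratio (t : T) : set S := [set s : S | exists2 u,
  u * \prod_i t.1.1 (t.1.2 i) (t.2 (i + 1)) = 1 &
  u * \prod_i t.1.1 (t.1.2 i) (t.2 i) = s].
have finite_ratio t : finite_set (ratio t).
  have [->|/set0P[s [u u1 us]]] := eqVneq (ratio t) set0.
    exact: finite_set0.
  apply: sub_finite_set (finite_set1 s) => s' [u' u'1 us'] /=.
  (* [u] and [u'] are inverses of the same element *)
  have uu' : u' = u by rewrite -[LHS]mulr1 -u1 mulrCA u'1 mulr1.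
  by rewrite -us -us' uu'.
pose data : set T := [set` G] `*` setT `*` setT.
have finite_data : finite_set data.
  by apply: finite_setX (finite_setX (finite_seq G) _) _; exact: finite_finset.
apply: S_infinite.
apply: (@sub_finite_set _ _ (0 |` \bigcup_(t in data) ratio t)).
  move=> s _; have [->|nzs] := eqVneq s 0; [by left|right].
  have [w wG def_s] := genG (cycle_mx m s).
  have sel1 : row_select id (1%:M : 'M[S]_m.+3).
    by move=> i k; rewrite mxE; have [->|_] := eqVneq i k; rewrite ?eqxx.
  have := @cycle_supported_word m S S_antinegative S_nzd w _ _ sel1.
  rewrite mul1mx -def_s => /(_ (cycle_mx_supported nz1 nzs)).
  move=> [g [D [E [f [h [gw selD selE eqX]]]]]].
  have [u u1 us] := cycle_mx_factor selD selE eqX.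
  exists (g, finfun f, finfun h); first by split; [split; [exact: wG|]|].
  by exists u; [rewrite -[RHS]u1|rewrite -[RHS]us]; congr (_ * _);
    apply: eq_bigr => i _; rewrite /= !ffunE.
rewrite finite_setU; split; first exact: finite_set1.
by apply: bigcup_finite.
Qed.
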